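(* Let $s$ be a positive integer, $Q=q^s$, and let $\rho=(\rho_1,\dots,\rho_m)$, $m\ge1$, be a sequence of integers between $1$ and $s-1$. Then $$\sum_{\lambda:\ \mathrm{rem}_s(\lambda)=\rho}R^{r_s(\lambda)}C^{c_s(\lambda)}q^{|\lambda|}=q^{|\rho|}Q^{-\mathrm{wmaj}(\rho)}\sum_{i\ge m}Q^{\binom m2+i-m}\begin{bmatrix} i-1\\ m-1\end{bmatrix}_Q\left(R^{i-m}+\sum_{k\ge1}\frac{CQ^k}{(CQ;Q)_k}R^{\max(i-m,\,k-m)}\right).$$
   Context: A partition $\lambda$ has size $|\lambda|=\sum\lambda_i$ and is identified with its Ferrers diagram. For a cell $z$, $\mathrm{leg}(z)$ is the number of cells strictly below $z$ in its column and $\mathrm{arm}(z)$ the number of cells strictly to its right in its row. $r_s(\lambda)$ is the number of parts divisible by $s$; $c_s(\lambda)$ is the number of cells $z$ with $\mathrm{leg}(z)=0$ and $s\mid\mathrm{arm}(z)+1$. $\mathrm{rem}_s(\lambda)$ is the sequence of non-zero remainders of $\lambda_1,\lambda_2,\dots$ modulo $s$, in order; $|\rho|=\sum\rho_j$; $\mathrm{wmaj}(\rho)=\sum_{j:\,1\le j<m,\ \rho_j\ge\rho_{j+1}}j$. $\begin{bmatrix} n\\ k\end{bmatrix}_Q=\frac{[n]_Q!}{[k]_Q![n-k]_Q!}$ with $[n]_Q!=\prod_{i=1}^n\frac{1-Q^i}{1-Q}$. $(a;Q)_k=\prod_{i=0}^{k-1}(1-aQ^i)$. Identities are of formal power series in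 $q$ with coefficients polynomials in $R,C$. *)

(* Defs.v *)
From HB Require Import structures.
From mathcomp Require Import all_boot all_order all_algebra.
From mathcomp Require Import boolp classical_sets cardinality fsbigop.

Set Implicit Arguments.
Unset Strict Implicit.
Unset Printing Implicit Defensive.

Import GRing.Theory.

Local Open Scope ring_scope.

(* A one-field record rather than [nat -> A], whose canonical ring structure
   has the pointwise product. *)
Record fps (A : Type) := FPS { fcoef : nat -> A }.

Lemma fpsP (A : Type) (f g : fps A) : fcoef f =1 fcoef g -> f = g.
Proof. by case: f g => [f] [g] /= /funext ->. Qed.

HB.instance Definition _ (A : Type) := gen_eqMixin (fps A).
HB.instance Definition _ (A : Type) := gen_choiceMixin (fps A).

Section FpsZmodule.
Variable A : zmodType.
Implicit Types f g h : fps A.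

Definition fps_zero : fps A := FPS (fun=> 0).
Definition fps_opp f : fps A := FPS (fun n => - fcoef f n).
Definition fps_add f g : fps A := FPS (fun n => fcoef f n + fcoef g n).

Fact fps_addA : associative fps_add.
Proof. by move=> f g h; apply: fpsP => n; rewrite /= addrA. Qed.
Fact fps_addC : commutative fps_add.
Proof. by move=> f g; apply: fpsP => n; rewrite /= addrC. Qed.
Fact fps_add0 : left_id fps_zero fps_add.
Proof. by move=> f; apply: fpsP => n; rewrite /= add0r. Qed.
Fact fps_addN : left_inverse fps_zero fps_opp fps_add.
Proof. by move=> f; apply: fpsP => n; rewrite /= addNr. Qed.

HB.instance Definition _ :=
  GRing.isZmodule.Build (fps A) fps_addA fps_addC fps_add0 fps_addN.

End FpsZmodule.

Section FpsRing.
Variable A : comNzRingType.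
Implicit Types f g h : fps A.

Definition fps_one : fps A := FPS (fun n => (n == 0)%N%:R).
Definition fps_mul f g : fps A :=
  FPS (fun n => \sum_(i < n.+1) fcoef f i * fcoef g (n - i)).

Let trunc n f : {poly A} := \poly_(i < n.+1) fcoef f i.

Let truncE n f i : (i <= n)%N -> (trunc n f)`_i = fcoef f i.
Proof. by move=> le_in; rewrite coef_poly ltnS le_in. Qed.

Let trunc_mul n f g i : (i <= n)%N ->
  fcoef (fps_mul f g) i = (trunc n f * trunc n g)`_i.
Proof.
move=> le_in; rewrite coefM /=; apply: eq_bigr => j _.
rewrite !truncE //; first exact: leq_trans (leq_subr _ _) le_in.
by apply: leq_trans le_in; rewrite -ltnS.
Qed.

Fact fps_mulC : commutative fps_mul.
Proof.
by move=> f g; apply: fpsP => n; rewrite !(@trunc_mul n) // mulrC.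
Qed.

Fact fps_mulA : associative fps_mul.
Proof.
move=> f g h; apply: fpsP => n.
transitivity (trunc n f * (trunc n g * trunc n h))`_n.
  rewrite coefM /=; apply: eq_bigr => i _; have lein := ltn_ord i.
  rewrite truncE -1?ltnS //; congr (_ * _).
  by rewrite -(@trunc_mul n) // leq_subr.
rewrite mulrA coefM /=; apply: eq_bigr => i _; have lein := ltn_ord i.
rewrite (@truncE n h) ?leq_subr //; congr (_ * _).
by rewrite -(@trunc_mul n) // -ltnS.
Qed.

Fact fps_mul1 : left_id fps_one fps_mul.
Proof.
move=> f; apply: fpsP => n /=.
by rewrite big_ord_recl /= mul1r subn0 big1 ?addr0 // => i _; rewrite mul0r.
Qed.

Fact fps_mulD : left_distributive fps_mul +%R.
Proof.
move=> f g h; apply: fpsP => n /=.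
by rewrite -big_split /=; apply: eq_bigr => i _; rewrite mulrDl.
Qed.

Fact fps_oner_neq0 : fps_one != 0.
Proof.
apply/eqP => /(congr1 (fun f : fps A => fcoef f 0%N)) /= /eqP.
by rewrite oner_eq0.
Qed.

HB.instance Definition _ := GRing.Zmodule_isComNzRing.Build (fps A)
  fps_mulA fps_mulC fps_mul1 fps_mulD fps_oner_neq0.

Definition fpsC (a : A) : fps A := FPS (fun n => if n is 0 then a else 0).
Definition fpsX : fps A := FPS (fun n => (n == 1)%N%:R).

End FpsRing.
Arguments fpsX {A}.

Section FpsUnit.
Variable A : comUnitRingType.
Implicit Types f g h : fps A.

Definition fps_unit : pred (fps A) := [pred f | fcoef f 0 \is a GRing.unit].

(* The coefficients of index < n of the inverse, from the recurrence
   f_0 g_n = [n = 0] - \sum_(i < n) g_i f_(n-i). *)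
Fixpoint fps_inv_seq f n : seq A :=
  if n is k.+1 then
    let s := fps_inv_seq f k in
    rcons s ((fcoef f 0)^-1 *
             ((k == 0)%N%:R - \sum_(i < k) s`_i * fcoef f (k - i)))
  else [::].

Definition fps_inv f : fps A :=
  if fps_unit f then FPS (fun n => (fps_inv_seq f n.+1)`_n) else f.

Let size_inv_seq f n : size (fps_inv_seq f n) = n.
Proof. by elim: n => //= n IHn; rewrite size_rcons IHn. Qed.

Let nth_inv_seq f n i : (i < n)%N ->
  (fps_inv_seq f n)`_i = (fps_inv_seq f i.+1)`_i.
Proof.
elim: n => // n IHn; rewrite ltnS leq_eqVlt => /predU1P[-> //|lt_in].
by rewrite -(IHn lt_in) /= nth_rcons size_inv_seq lt_in.
Qed.

Fact fps_mulVf : {in fps_unit, left_inverse 1 fps_inv *%R}.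
Proof.
move=> f Uf; apply: fpsP => n.
have {Uf} U0 : fcoef f 0 \is a GRing.unit by [].
have -> : fps_inv f = FPS (fun n => (fps_inv_seq f n.+1)`_n).
  by rewrite /fps_inv /fps_unit /= U0.
rewrite [LHS]/= big_ord_recr /= subnn.
rewrite nth_rcons size_inv_seq ltnn eqxx mulrAC mulVr // mul1r.
under eq_bigr => i _.
  rewrite -/(fps_inv_seq f i.+1) -(@nth_inv_seq f n) //; over.
by rewrite addrC subrK.
Qed.

Fact fps_unitPl f g : g * f = 1 -> fps_unit f.
Proof.
move=> /(congr1 (fun h : fps A => fcoef h 0%N)) /=.
rewrite big_ord_recl big_ord0 addr0 subnn => gf1.
by apply/unitrPr; exists (fcoef g 0%N); rewrite mulrC.
Qed.

Fact fps_inv_out : {in [predC fps_unit], fps_inv =1 id}.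
Proof. by move=> f nUf; rewrite /fps_inv ifN. Qed.

HB.instance Definition _ := GRing.ComNzRing_hasMulInverse.Build (fps A)
  fps_mulVf fps_unitPl fps_inv_out.

End FpsUnit.

Section FpsIdomain.
Variable A : idomainType.

Fact fps_integral (f g : fps A) : f * g = 0 -> (f == 0) || (g == 0).
Proof.
have low (h : fps A) : h != 0 ->
    exists n, fcoef h n != 0 /\ forall i, (i < n)%N -> fcoef h i = 0.
  move=> h0; have /ex_minnP[n nz_n min_n] : exists n, fcoef h n != 0.
    apply/not_existsP => h00; case/eqP: h0; apply: fpsP => n /=.
    by apply/eqP/negPn/negP/h00.
  exists n; split=> // i; apply: contraTeq => nz_i.
  by rewrite -leqNgt min_n.
move=> fg0; apply/norP => -[/low[a [fa minf]] /low[b [gb ming]]].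
have /eqP := congr1 (fun h : fps A => fcoef h (a + b)%N) fg0.
rewrite [X in X == _]/= (bigD1 (inord a)) //=; set rest := (X in _ + X).
have -> : rest = 0.
  apply: big1 => i; rewrite -(inj_eq val_inj) /= inordK ?ltnS ?leq_addr //.
  rewrite neq_ltn => /orP[/minf ->|lt_ai]; first by rewrite mul0r.
  rewrite ming ?mulr0 // ltn_subLR 1?ltn_add2r //.
  by rewrite -ltnS.
rewrite inordK ?ltnS ?leq_addr // addr0 addKn mulf_eq0.
by rewrite (negPf fa) (negPf gb).
Qed.

HB.instance Definition _ :=
  GRing.ComUnitRing_isIntegral.Build (fps A) fps_integral.

End FpsIdomain.

Section FpsSum.
Variables (A : zmodType) (I : choiceType).
Implicit Types (D : set I) (F : I -> fps A).

Definition fps_summable D F :=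
  forall n, finite_set [set i | D i /\ fcoef (F i) n <> 0].

(* Meaningful under [fps_summable D F]: [\sum_(i \in D)] sums over the support
   when it is finite, and is 0 otherwise. *)
Definition fps_sum D F : fps A := FPS (fun n => \sum_(i \in D) fcoef (F i) n).

End FpsSum.

Section QAnalogues.
Variable B : unitRingType.

Definition qfact (Q : B) n := \prod_(1 <= i < n.+1) ((1 - Q ^+ i) / (1 - Q)).

Definition qbinom (Q : B) n k := qfact Q n / (qfact Q k * qfact Q (n - k)).

Definition qpoch (a Q : B) k := \prod_(0 <= i < k) (1 - a * Q ^+ i).

End QAnalogues.

Definition is_intpart (la : seq nat) := sorted geq la && (0%N \notin la).

Record intpart := IntPart { parts :> seq nat; _ : is_intpart parts }.

HB.instance Definition _ := [isSub for parts].
HB.instance Definition _ := [Countable of intpart by <:].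

Section Statistics.
Local Open Scope nat_scope.
Implicit Types (la rho : seq nat) (z : nat * nat).

(* The cell (i, j) lies in row i, counted from the top, and in column j,
   counted from the left, both starting at 0. *)
Definition cells la : seq (nat * nat) :=
  [seq (i, j) | i <- iota 0 (size la), j <- iota 0 (nth 0 la i)].

Definition leg la z := count (fun w => (w.2 == z.2) && (z.1 < w.1)) (cells la).

Definition arm la z := count (fun w => (w.1 == z.1) && (z.2 < w.2)) (cells la).

Definition rstat s la := count (dvdn s) la.

Definition cstat s la :=
  count (fun z => (leg la z == 0) && (s %| arm la z + 1)) (cells la).

Definition rems s la := [seq x <- [seq p %% s | p <- la] | x != 0].

(* [nth 0 rho j.-1] is the j-th entry of rho, counted from 1. *)
Definition wmaj rho :=
  \sum_(1 <= j < size rho | nth 0 rho j.-1 >= nth 0 rho j) j.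

End Statistics.

(* The coefficient ring is Z[C][R]: R is the outer polynomial variable. *)
Definition varR : fps {poly {poly int}} := fpsC 'X.
Definition varC : fps {poly {poly int}} := fpsC 'X%:P.

(* Main.v *)
Require Import Defs.
From HB Require Import structures.
From mathcomp Require Import all_boot all_order all_algebra.
From mathcomp Require Import ring zify.
From mathcomp Require Import boolp classical_sets functions cardinality fsbigop.

Set Implicit Arguments.
Unset Strict Implicit.
Unset Printing Implicit Defensive.

Import GRing.Theory.

Local Open Scope classical_set_scope.
Local Open Scope ring_scope.

(** Read the parts in increasing order, allowing zeros, and fix their number
    [n]. Adding [s] to every part multiplies the weight [C^c_s q^|mu|] by
    [C Q^n], so a family stable under this shift has a generating function
    equal to that of its members with smallest part less than [s], divided by
    [1 - C Q^n]. For such a member, deleting its smallest part leaves [n - 1]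
    parts; iterating this gives, for fixed [n] and remainder sequence [rho] of
    length [m], the closed form
      [q^|rho| Q^a [n choose m]_Q / (CQ; Q)_n],
    where [a] is the sum of the ascent positions of [rho], so that
    [a + wmaj rho = binomial m 2]; the two cases of the induction, an ascent
    or not, are the two [q]-Pascal rules. Discarding the sequences that start
    with a zero and summing over [n] gives the left-hand side. On the right
    the terms with [k <= i] telescope, as
    [1 / (CQ; Q)_k - 1 / (CQ; Q)_(k-1) = C Q^k / (CQ; Q)_k], and comparing
    the coefficients of [R^(n-m)] leaves the [q]-hockey-stick identity. *)

(** * Formal power series and their infinite sums *)

Section FpsCoef.
Variable A : comNzRingType.
Implicit Types f g : fps A.

Lemma fcoefD f g n : fcoef (f + g) n = fcoef f n + fcoef g n.
Proof. by []. Qed.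

Lemma fcoefM f g n :
  fcoef (f * g) n = \sum_(i < n.+1) fcoef f i * fcoef g (n - i).
Proof. by []. Qed.

Lemma fcoef_sum (I : Type) (r : seq I) (P : pred I) (F : I -> fps A) n :
  fcoef (\sum_(i <- r | P i) F i) n = \sum_(i <- r | P i) fcoef (F i) n.
Proof. exact: (big_morph (fun f : fps A => fcoef f n)). Qed.

Lemma fcoefXn k n : fcoef (fpsX ^+ k : fps A) n = (n == k)%:R.
Proof.
elim: k n => [|k IHk] n; first by rewrite expr0.
rewrite exprS fcoefM; case: n => [|n].
  by rewrite big_ord_recl big_ord0 /= mul0r addr0.
rewrite 2!big_ord_recl /= mul0r add0r mul1r big1 ?addr0 => [|i _].
  by rewrite subSS subn0 IHk eqSS.
by rewrite mul0r.
Qed.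

Lemma fcoefCM c f n : fcoef (fpsC c * f) n = c * fcoef f n.
Proof.
by rewrite fcoefM big_ord_recl /= subn0 big1 ?addr0 // => i _; rewrite mul0r.
Qed.

Lemma fpsCX c k : fpsC c ^+ k = fpsC (c ^+ k) :> fps A.
Proof.
elim: k => [|k IHk]; first by apply: fpsP => -[].
rewrite exprS IHk; apply: fpsP => n; rewrite fcoefCM exprS.
by case: n => //= n; rewrite mulr0.
Qed.

Definition fps_ord_ge n f := forall j, (j < n)%N -> fcoef f j = 0.

Lemma fps_ord_geXn n : fps_ord_ge n (fpsX ^+ n).
Proof. by move=> j; rewrite fcoefXn; case: ltngtP. Qed.

Lemma fps_ord_geM a b f g :
  fps_ord_ge a f -> fps_ord_ge b g -> fps_ord_ge (a + b) (f * g).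
Proof.
move=> fa gb j lt_j; rewrite fcoefM big1 // => i _.
have [/fa->|le_ai] := ltnP i a; first by rewrite mul0r.
rewrite gb ?mulr0 // ltn_subLR; last by rewrite -ltnS.
by rewrite (leq_trans lt_j) // leq_add2r.
Qed.

Lemma fps_ord_geMr a f g : fps_ord_ge a f -> fps_ord_ge a (f * g).
Proof. by rewrite -{2}[a]addn0 => fa; apply: fps_ord_geM. Qed.

Lemma fps_ord_geMl a f g : fps_ord_ge a g -> fps_ord_ge a (f * g).
Proof. by rewrite mulrC; apply: fps_ord_geMr. Qed.

Lemma fps_ord_geW a b f : (a <= b)%N -> fps_ord_ge b f -> fps_ord_ge a f.
Proof. by move=> le_ab fb j lt_ja; apply: fb; apply: leq_trans le_ab. Qed.

(** Truncation under a product: lower coefficients suffice, so an infinite sum inside a factor may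
    be replaced by a finite one. *)
Lemma fcoefM_eqr n f g h : (forall j, (j <= n)%N -> fcoef g j = fcoef h j) ->
  fcoef (f * g) n = fcoef (f * h) n.
Proof.
move=> eq_gh; rewrite !fcoefM; apply: eq_bigr => i _.
by rewrite eq_gh ?leq_subr.
Qed.

End FpsCoef.

Section FpsSums.
Variables (A : comNzRingType) (I : choiceType).
Implicit Types (D E : set I) (F G : I -> fps A) (r : seq I).

Lemma fcoef_fps_sum D F n r : uniq r ->
    (forall i, D i -> fcoef (F i) n <> 0 -> i \in r) ->
  fcoef (fps_sum D F) n = \sum_(i <- r | i \in D) fcoef (F i) n.
Proof.
move=> Ur suppr; rewrite [LHS]/=.
rewrite (fsbigE [seq i <- r | i \in D]) ?filter_uniq //=.
- by rewrite big_filter_cond; apply: eq_bigl => i; rewrite andbb.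
- by move=> i /=; rewrite mem_filter => /andP[/set_mem].
- move=> i Di; rewrite mem_filter mem_set //= => /negP ri.
  by apply: contrapT => /(suppr i Di).
Qed.

(** One list serves all coefficients up to [n] at once, as needed for products, whose [n]-th
    coefficient involves all the lower ones. *)
Lemma fps_summable_seq D F n : fps_summable D F ->
  exists2 r, uniq r &
    forall i j, D i -> (j <= n)%N -> fcoef (F i) j <> 0 -> i \in r.
Proof.
move=> sF; have supp j : exists r : seq I,
    forall i, D i -> fcoef (F i) j <> 0 -> i \in r.
  have /finite_seqP[r def_r] := sF j; exists r => i Di nz_i.
  by have: [set` r] i by rewrite -def_r.
elim: n => [|n [r _ IHr]].
  have [r suppr] := supp 0%N; exists (undup r); first exact: undup_uniq.
  by move=> i j Di; rewrite leqn0 => /eqP-> /(suppr i Di); rewrite mem_undup.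
have [r' suppr'] := supp n.+1; exists (undup (r ++ r')).
  exact: undup_uniq.
move=> i j Di; rewrite mem_undup mem_cat leq_eqVlt => /predU1P[->|lt_j] nz.
  by rewrite suppr' ?orbT.
by rewrite (IHr i j).
Qed.

Lemma eq_fps_sum D F G : (forall i, D i -> F i = G i) ->
  fps_sum D F = fps_sum D G.
Proof.
by move=> eqFG; apply: fpsP => n; apply: eq_fsbigr => i /set_mem/eqFG->.
Qed.

Lemma eq_fps_suml D E F : (forall i, D i <-> E i) ->
  fps_sum D F = fps_sum E F.
Proof. by move=> eqDE; congr fps_sum; apply/funext => i; apply/propext. Qed.

Lemma fps_sum0 F : fps_sum set0 F = 0.
Proof. by apply: fpsP => n; rewrite /= fsbig_set0. Qed.

Lemma fps_sum1 i F : fps_sum [set i] F = F i.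
Proof. by apply: fpsP => n; rewrite /= fsbig_set1. Qed.

Lemma fps_sumID E D F : fps_summable D F ->
  fps_sum D F = fps_sum (D `&` E) F + fps_sum (D `&` ~` E) F.
Proof.
move=> sF; apply: fpsP => n; rewrite fcoefD.
have [r Ur suppr] := fps_summable_seq n sF.
rewrite !(@fcoef_fps_sum _ _ _ r) //=; first last.
- by move=> i Di; apply: (suppr i n).
- by move=> i [Di _]; apply: (suppr i n).
- by move=> i [Di _]; apply: (suppr i n).
rewrite (bigID (mem E)) /=; congr (_ + _); apply: eq_bigl => i.
  by rewrite in_setI.
by rewrite in_setI in_setC.
Qed.

Lemma fps_sumM c D F : fps_summable D F ->
  fps_sum D (fun i => c * F i) = c * fps_sum D F.
Proof.
move=> sF; apply: fpsP => n; have [r Ur suppr] := fps_summable_seq n sF.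
rewrite (@fcoef_fps_sum _ _ _ r) // => [|i Di]; last first.
  apply: contra_notP => ri; rewrite fcoefM big1 // => j _.
  have [->|/eqP nz] := eqVneq (fcoef (F i) (n - j)) 0; first by rewrite mulr0.
  by case: ri; apply: suppr Di _ nz; rewrite leq_subr.
under eq_bigr do rewrite fcoefM.
rewrite exchange_big fcoefM; apply: eq_bigr => j _.
rewrite (@fcoef_fps_sum _ _ _ r) ?big_distrr //= => i Di.
by apply: suppr Di _; rewrite leq_subr.
Qed.

(** The sum is split along the fibers of [g]. The statement is about a single coefficient because
    the range of relevant values of [g] may grow with [n]. *)
Lemma fcoef_fps_sum_fibers (g : I -> nat) D F n a b : fps_summable D F ->
    (forall i, D i -> fcoef (F i) n <> 0 -> (a <= g i < b)%N) ->
  fcoef (fps_sum D F) n =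
    \sum_(a <= k < b) fcoef (fps_sum (D `&` [set i | g i = k]) F) n.
Proof.
move=> sF g_bound; have [r Ur suppr] := fps_summable_seq n sF.
transitivity (\sum_(a <= k < b) \sum_(i <- r | (i \in D) && (g i == k))
                fcoef (F i) n); last first.
  apply: eq_bigr => k _; rewrite (@fcoef_fps_sum _ _ _ r) //; last first.
    by move=> i [Di _]; apply: (suppr i n).
  apply: eq_bigl => i; rewrite in_setI; congr (_ && _).
  by apply/eqP/idP => [<-|/set_mem//]; apply/mem_set.
rewrite (@fcoef_fps_sum _ _ _ r) //; last by move=> i Di; apply: (suppr i n).
rewrite (exchange_big_dep (fun i => i \in D)) /=; last by move=> k i _ /andP[].
apply: eq_bigr => i Di; rewrite Di /=.
have [->|/eqP nz] := eqVneq (fcoef (F i) n) 0; first by rewrite big1.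
under eq_bigl do rewrite eq_sym.
rewrite -big_filter filter_pred1_uniq ?big_seq1 ?iota_uniq //.
by rewrite mem_index_iota; apply: g_bound => //; apply: set_mem.
Qed.

End FpsSums.

Lemma reindex_fps_sum (A : comNzRingType) (I J : choiceType) (h : I -> J)
    (D : set I) (E : set J) (F : J -> fps A) : set_bij D E h ->
  fps_sum E F = fps_sum D (fun i => F (h i)).
Proof. by move=> bij_h; apply: fpsP => n; apply: reindex_fsbig. Qed.

Section FpsSumNat.
Variables (A : comNzRingType) (m : nat) (F : nat -> fps A).
Hypothesis ordF : forall i, (m <= i)%N -> fps_ord_ge (i - m) (F i).

Let suppF n i : (m <= i)%N -> fcoef (F i) n <> 0 -> (i <= n + m)%N.
Proof.
move=> le_mi; apply: contra_notT; rewrite -ltnNge => lt_i.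
by apply: ordF; rewrite // ltn_subRL addnC.
Qed.

Lemma fps_summable_nat : fps_summable [set i | (m <= i)%N] F.
Proof.
move=> n; apply: (sub_finite_set _ (finite_II (n + m).+1)) => i /= [le_mi].
by move/(suppF le_mi).
Qed.

Lemma fcoef_fps_sum_nat n M : (n + m < M)%N ->
  fcoef (fps_sum [set i | (m <= i)%N] F) n =
    fcoef (\sum_(m <= i < M) F i) n.
Proof.
move=> lt_nM; rewrite fcoef_sum.
rewrite (@fcoef_fps_sum _ _ _ _ _ (index_iota m M)) ?iota_uniq //.
  rewrite big_nat_cond [RHS]big_nat_cond; apply: eq_bigl => i.
  by case: (m <= i < M)%N / andP => //= -[le_mi _]; rewrite mem_set.
move=> i /= le_mi /(suppF le_mi) le_i; rewrite mem_index_iota le_mi.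
exact: leq_ltn_trans le_i lt_nM.
Qed.

End FpsSumNat.

(** * Gaussian binomials and q-Pochhammer symbols *)

Section QIdentities.
Variables (B : comUnitRingType) (Q : B).
Hypothesis unitQ : forall i, (0 < i)%N -> 1 - Q ^+ i \is a GRing.unit.

Lemma qfactS n : qfact Q n.+1 = qfact Q n * ((1 - Q ^+ n.+1) / (1 - Q)).
Proof. by rewrite /qfact big_nat_recr. Qed.

Let unitQ1 : 1 - Q \is a GRing.unit.
Proof. by rewrite -[Q]expr1 unitQ. Qed.

Lemma qfact_unit n : qfact Q n \is a GRing.unit.
Proof.
elim: n => [|n IHn]; first by rewrite /qfact big_nil unitr1.
by rewrite qfactS unitrMl ?unitrM ?unitrV ?unitQ ?unitQ1.
Qed.

Lemma qbinomn0 n : qbinom Q n 0 = 1.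
Proof. by rewrite /qbinom subn0 {2}/qfact big_nil mul1r divrr ?qfact_unit. Qed.

Lemma qbinomnn n : qbinom Q n n = 1.
Proof.
by rewrite /qbinom subnn {3}/qfact big_nil mulr1 divrr ?qfact_unit.
Qed.

Lemma qbinom_fact m z :
  qbinom Q (m + z) m * (qfact Q m * qfact Q z) = qfact Q (m + z).
Proof. by rewrite /qbinom addKn divrK // unitrM !qfact_unit. Qed.

(** The multiplier is a common denominator for the three binomials of a Pascal rule; [qbinomL],
    [qbinomR] and [qbinomLR] give the resulting numerators as multiples of [qfact Q (m + z).+1]. *)
Let mulQf_inj n (x y : B) :
  x * ((qfact Q n.1.+1 * qfact Q n.2.+1) * (1 - Q)) =
  y * ((qfact Q n.1.+1 * qfact Q n.2.+1) * (1 - Q)) -> x = y.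
Proof. by apply: mulIr; rewrite !unitrM !qfact_unit. Qed.

Let qfactSE n : qfact Q n.+1 * (1 - Q) = qfact Q n * (1 - Q ^+ n.+1).
Proof. by rewrite qfactS -mulrA divrK. Qed.

Let qbinomL m z : qbinom Q (m + z.+1) m *
    ((qfact Q m.+1 * qfact Q z.+1) * (1 - Q)) =
  qfact Q (m + z).+1 * (1 - Q ^+ m.+1).
Proof.
by rewrite [_ * qfact Q z.+1 * _]mulrAC qfactSE -addnS -qbinom_fact; ring.
Qed.

Let qbinomR m z : qbinom Q (m.+1 + z) m.+1 *
    ((qfact Q m.+1 * qfact Q z.+1) * (1 - Q)) =
  qfact Q (m + z).+1 * (1 - Q ^+ z.+1).
Proof.
by rewrite -[_ * qfact Q z.+1 * _]mulrA qfactSE -addSn -qbinom_fact; ring.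
Qed.

Let qbinomLR m z : qbinom Q (m.+1 + z.+1) m.+1 *
    ((qfact Q m.+1 * qfact Q z.+1) * (1 - Q)) =
  qfact Q (m + z).+1 * (1 - Q ^+ (m.+1 + z.+1)).
Proof. by rewrite mulrA qbinom_fact addnS qfactSE addSn. Qed.

(** Over the common denominator this is [1 - Q^(a+b) = (1 - Q^a) + Q^a (1 - Q^b)] with [a = m + 1]
    and [b = z + 1]; [qbinomS_high] exchanges the roles of [a] and [b]. *)
Lemma qbinomS_low m z : qbinom Q (m.+1 + z.+1) m.+1 =
  qbinom Q (m + z.+1) m + Q ^+ m.+1 * qbinom Q (m.+1 + z) m.+1.
Proof.
apply: (@mulQf_inj (m, z)); rewrite mulrDl -[Q ^+ _ * _ * _]mulrA /=.
rewrite qbinomLR qbinomL qbinomR exprD; ring.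
Qed.

Lemma qbinomS_high m z : qbinom Q (m.+1 + z.+1) m.+1 =
  Q ^+ z.+1 * qbinom Q (m + z.+1) m + qbinom Q (m.+1 + z) m.+1.
Proof.
apply: (@mulQf_inj (m, z)); rewrite mulrDl -[Q ^+ _ * _ * _]mulrA /=.
rewrite qbinomLR qbinomL qbinomR exprD; ring.
Qed.

Lemma sum_qbinom m z :
  \sum_(0 <= j < z.+1) Q ^+ j * qbinom Q (m + j) m = qbinom Q (m.+1 + z) m.+1.
Proof.
elim: z => [|z IHz]; first by rewrite big_nat1 !addn0 !qbinomnn mulr1.
by rewrite big_nat_recr //= IHz qbinomS_high addrC.
Qed.

Variable C : B.
Hypothesis unitCQ : forall i, (0 < i)%N -> 1 - C * Q ^+ i \is a GRing.unit.

Lemma qpochCQS k :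
  qpoch (C * Q) Q k.+1 = qpoch (C * Q) Q k * (1 - C * Q ^+ k.+1).
Proof. by rewrite /qpoch big_nat_recr //= -mulrA -exprS. Qed.

Lemma qpochCQ_unit k : qpoch (C * Q) Q k \is a GRing.unit.
Proof.
elim: k => [|k IHk]; first by rewrite /qpoch big_nil unitr1.
by rewrite qpochCQS unitrMl ?unitCQ.
Qed.

Lemma sum_qpochV N :
  1 + \sum_(1 <= k < N.+1) C * Q ^+ k / qpoch (C * Q) Q k =
    (qpoch (C * Q) Q N)^-1.
Proof.
elim: N => [|N IHN]; first by rewrite big_nil addr0 /qpoch big_nil invr1.
rewrite big_nat_recr //= addrA IHN; apply: (mulIr (qpochCQ_unit N.+1)).
rewrite mulVr ?qpochCQ_unit // mulrDl divrK ?qpochCQ_unit // qpochCQS mulrA.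
by rewrite mulVr ?qpochCQ_unit // mul1r subrK.
Qed.

(* The left-hand side is the right-hand side of the theorem truncated at [M]:
   telescoping the terms with [k <= i] leaves only the powers
   [R ^+ (N - m)], whose coefficients are collected on the right. *)
Lemma collect_qpoch (R : B) (b : nat -> B) m M : (0 < m)%N ->
  \sum_(m <= i < M) b i * (R ^+ (i - m) +
     \sum_(1 <= k < M)
        C * Q ^+ k / qpoch (C * Q) Q k * R ^+ maxn (i - m) (k - m)) =
  \sum_(m <= N < M) R ^+ (N - m) * (qpoch (C * Q) Q N)^-1 *
     (b N + C * Q ^+ N * \sum_(m <= i < N) b i).
Proof.
move=> m_gt0; set P := qpoch (C * Q) Q.
have split_k i : (m <= i < M)%N ->
    R ^+ (i - m) + \sum_(1 <= k < M)
        C * Q ^+ k / P k * R ^+ maxn (i - m) (k - m) =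
    R ^+ (i - m) / P i + \sum_(i.+1 <= k < M) C * Q ^+ k / P k * R ^+ (k - m).
  case/andP=> le_mi lt_iM; rewrite (big_cat_nat _ (n := i.+1)) //= addrA.
  congr (_ + _).
    rewrite -sum_qpochV mulrDr mulr1 mulr_sumr; congr (_ + _).
    apply: eq_big_nat => k /andP[_ le_ki]; rewrite mulrC (maxn_idPl _) //.
    exact: leq_sub2r.
  apply: eq_big_nat => k /andP[lt_ik _]; rewrite (maxn_idPr _) //.
  exact: leq_sub2r (ltnW lt_ik).
(* The lower bound [i.+1] becomes a condition, so that both indices range over the same interval and
   the double sum can be exchanged. *)
transitivity (\sum_(m <= i < M) (b i * R ^+ (i - m) / P i +
    \sum_(m <= k < M | (i < k)%N) b i * (C * Q ^+ k / P k * R ^+ (k - m)))).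
  apply: eq_big_nat => i lt_i; rewrite split_k // mulrDr mulrA mulr_sumr.
  by rewrite [in LHS](@big_nat_widenl _ _ _ i.+1 m) // leqW //; case/andP: lt_i.
rewrite big_split /= (exchange_big_dep_nat predT) //= -big_split /=.
apply: eq_big_nat => N /andP[_ ltN]; rewrite -mulr_suml.
by rewrite [in RHS](@big_nat_widen _ _ _ _ N M) ?(ltnW ltN) //; ring.
Qed.

End QIdentities.

(** * Generating functions of increasing sequences *)

Lemma finite_bounded_seqs a b :
  finite_set [set mu : seq nat |
    (size mu <= a)%N /\ forall x, x \in mu -> (x <= b)%N].
Proof.
elim: a => [|a IHa].
  by apply: (sub_finite_set _ (finite_set1 [::])) => -[|x mu] /= [].
apply: (sub_finite_set (B := [set [::]] `|`
  [set (x :: mu) | x in `I_b.+1 & mu in _])); last first.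
  by rewrite finite_setU; split; [|apply: finite_image2 (finite_II b.+1) IHa].
move=> [|x mu] /= [le_a le_b]; [by left | right].
exists x; first by rewrite /= ltnS le_b ?mem_head.
by exists mu => //; split=> // y mu_y; rewrite le_b // inE mu_y orbT.
Qed.

Lemma leq_mem_sumn (x : nat) mu : x \in mu -> (x <= sumn mu)%N.
Proof.
by elim: mu => //= y mu IHmu; rewrite inE => /predU1P[->|/IHmu]; lia.
Qed.

(** * Adding [s] to every part *)

Section ShiftedSums.
Variables (s : nat) (A : comUnitRingType) (c : A).
Hypothesis s_gt0 : (0 < s)%N.
Implicit Types (mu : seq nat) (Y : set (seq nat)).

Let q : fps A := fpsX.
Let Q : fps A := q ^+ s.
Let C : fps A := fpsC c.

(* With [p = 0] this is [c_s] of the partition [rev mu]. *)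
Fixpoint gap_stat (p : nat) mu : nat :=
  if mu is x :: mu' then ((x - p) %/ s + gap_stat x mu')%N else 0.

(** [R] is absent: once the number of parts and the remainders are fixed, its exponent is
    constant. *)
Definition gap_weight mu : fps A := C ^+ gap_stat 0 mu * q ^+ sumn mu.

Definition shift mu := map (addn s) mu.

Lemma gap_stat_shift p mu : gap_stat (s + p) (shift mu) = gap_stat p mu.
Proof. by elim: mu p => //= x mu IHmu p; rewrite IHmu subnDl. Qed.

Lemma sumn_shift mu : sumn (shift mu) = (s * size mu + sumn mu)%N.
Proof. by elim: mu => [|x mu IHmu] /=; [rewrite muln0 | rewrite IHmu; lia]. Qed.

(** Only the gap below the smallest part changes, by [s], which yields the single factor [C]. *)
Lemma gap_weight_shift mu : (0 < size mu)%N ->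
  gap_weight (shift mu) = C * Q ^+ size mu * gap_weight mu.
Proof.
case: mu => // x mu _; rewrite /gap_weight sumn_shift /=.
rewrite gap_stat_shift !subn0 divnDl ?dvdnn // divnn s_gt0 -addnA add1n.
by rewrite exprS (exprD q) (exprM q); ring.
Qed.

Lemma shift_inj : injective shift.
Proof. exact/inj_map/addnI. Qed.

Lemma shiftK mu : all (leq s) mu -> shift (map (subn^~ s) mu) = mu.
Proof. by elim: mu => //= x mu IHmu /andP[le_sx /IHmu->]; rewrite subnKC. Qed.

Lemma sorted_shift mu : sorted leq (shift mu) = sorted leq mu.
Proof. by apply: mono_sorted => x y; apply: leq_add2l. Qed.

Lemma all_leq_head (p : nat) mu : (0 < size mu)%N -> sorted leq mu ->
  all (leq p) mu = (p <= head 0 mu)%N.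
Proof.
case: mu => //= x mu _; rewrite (path_sortedE leq_trans) => /andP[le_x _].
by case: leqP => //= le_px; apply: sub_all le_x => y; apply: leq_trans.
Qed.

Lemma head_shift mu : (0 < size mu)%N -> head 0 (shift mu) = (s + head 0 mu)%N.
Proof. by case: mu. Qed.

(** The equivalence, stronger than stability, makes [shift] map [Y] onto all its members with
    smallest part at least [s]. *)
Definition shift_invariant n Y :=
  [/\ forall mu, Y mu -> size mu = n, forall mu, Y mu -> sorted leq mu
    & forall mu, Y (shift mu) <-> Y mu].

Lemma gap_weight_summable n Y : (forall mu, Y mu -> size mu = n) ->
  fps_summable Y gap_weight.
Proof.
move=> sizeY k; apply: sub_finite_set (finite_bounded_seqs n k) => mu [Ymu].
rewrite /gap_weight fpsCX fcoefCM fcoefXn.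
have [def_k _|] := eqVneq k (sumn mu).
  by split=> [|x]; rewrite ?(sizeY mu) // def_k; apply: leq_mem_sumn.
by rewrite mulr0.
Qed.

(** The length [n.+1] excludes the empty sequence, which [shift] fixes and whose head is the default
    0. *)
Lemma shift_bij n Y : shift_invariant n.+1 Y ->
  set_bij Y (Y `&` [set mu | (s <= head 0 mu)%N]) shift.
Proof.
case=> sizeY sortY shY; split=> [mu Ymu|mu nu _ _|mu [Ymu le_s_mu]].
- by split; [apply/shY | rewrite /= head_shift ?leq_addr // (sizeY mu)].
- exact: shift_inj.
- have shmu: shift (map (subn^~ s) mu) = mu.
    by apply: shiftK; rewrite all_leq_head ?sortY // (sizeY mu).
  by exists (map (subn^~ s) mu) => //; apply/shY; rewrite shmu.
Qed.

Lemma sum_head_ge n Y : shift_invariant n.+1 Y ->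
  fps_sum (Y `&` [set mu | (s <= head 0 mu)%N]) gap_weight =
    C * Q ^+ n.+1 * fps_sum Y gap_weight.
Proof.
move=> shY; rewrite (reindex_fps_sum _ (shift_bij shY)); case: shY => sizeY _ _.
rewrite -fps_sumM; last exact: gap_weight_summable sizeY.
by apply: eq_fps_sum => mu /sizeY sz_mu; rewrite gap_weight_shift sz_mu.
Qed.

Lemma sum_head_lt n Y : shift_invariant n.+1 Y ->
  (1 - C * Q ^+ n.+1) * fps_sum Y gap_weight =
    fps_sum (Y `&` [set mu | (head 0 mu < s)%N]) gap_weight.
Proof.
move=> shY; have [sizeY _ _] := shY; rewrite mulrBl mul1r -(sum_head_ge shY).
rewrite {1}(fps_sumID [set mu | (s <= head 0 mu)%N]); last first.
  exact: gap_weight_summable sizeY.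
rewrite addrAC subrr add0r; apply: eq_fps_suml => mu.
split=> -[Ymu /= lt_mu]; split=> //=; first by rewrite ltnNge; apply/negP.
by apply/negP; rewrite -ltnNge.
Qed.

Definition cons_set (x : nat) Y : set (seq nat) :=
  [set x :: mu | mu in Y `&` [set mu | (x <= head 0 mu)%N]].

(** Heads have the form [a * s + y]. If [x <= y], every head is at least [x], and prepending [x]
    keeps the first quotient [a]. If [y < x], the heads that are at least [x] are those with
    [0 < a], so the tail is a shift; this costs a power of [Q] but no [C], since subtracting [x]
    lowers the quotient of the shifted head back by one. *)
Lemma sum_cons_set n Y (x y : nat) : (x < s)%N -> (y < s)%N ->
    shift_invariant n.+1 Y -> (forall mu, Y mu -> head 0 mu %% s = y)%N ->
  fps_sum (cons_set x Y) gap_weight =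
    q ^+ x * Q ^+ (n.+1 * (y < x)) * fps_sum Y gap_weight.
Proof.
move=> lt_xs lt_ys shY resY; have [sizeY sortY shiftY] := shY.
rewrite -fps_sumM; last exact: gap_weight_summable sizeY.
have hdE mu : Y mu -> {a | head 0 mu = a * s + y}%N.
  by move=> Ymu; exists (head 0 mu %/ s)%N; rewrite -{1}(resY mu) // -divn_eq.
have wt_cons mu h : gap_weight (x :: h :: mu) =
      C ^+ ((h - x) %/ s + gap_stat h mu) * q ^+ (x + (h + sumn mu)).
  by rewrite /gap_weight /= subn0 divn_small.
have [lt_yx|le_xy] := ltnP y x.
  rewrite (reindex_fps_sum (h := fun mu => x :: shift mu) (D := Y)
             (E := cons_set x Y)) /=; last first.
    have [sub_sh _ sur_sh] := shift_bij shY.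
    split=> [mu Ymu|mu nu _ _ [] /shift_inj//|_ [nu [Ynu /= le_x_nu] <-]].
      exists (shift mu) => //; have [Yshmu /= le_s] := sub_sh _ Ymu.
      by split=> //=; apply: leq_trans (ltnW lt_xs) le_s.
    have [|mu Ymu <-] := sur_sh nu; last by exists mu.
    split=> //=; have [[|a] def_h] := hdE _ Ynu; lia.
  apply: eq_fps_sum => -[|h mu] Ymu; first by have := sizeY _ Ymu.
  have [a /= def_h] := hdE _ Ymu; have [sz_mu] := sizeY _ Ymu.
  rewrite wt_cons gap_stat_shift sumn_shift sz_mu muln1 /gap_weight /= subn0.
  have -> : ((s + h - x) %/ s = h %/ s)%N.
    have -> : (s + h - x = a * s + (s + y - x))%N by lia.
    by rewrite def_h !divnMDl // !divn_small //; lia.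
  have -> : (x + (s + h + (s * n + sumn mu)) = x + s * n.+1 + (h + sumn mu))%N.
    by lia.
  by rewrite 2!(exprD q) (exprM q); ring.
rewrite (reindex_fps_sum (h := cons x) (D := Y)
           (E := cons_set x Y)) /=; last first.
  split=> [mu Ymu|mu nu _ _ []//|_ [nu [Ynu /= le_x_nu] <-]]; last by exists nu.
  by exists mu => //; split=> //=; have [a ->] := hdE _ Ymu; lia.
apply: eq_fps_sum => -[|h mu] Ymu; first by have := sizeY _ Ymu.
have [a /= def_h] := hdE _ Ymu.
rewrite wt_cons muln0 mulr1 /gap_weight /= subn0.
have -> : ((h - x) %/ s = h %/ s)%N.
  have -> : (h - x = a * s + (y - x))%N by lia.
  by rewrite def_h !divnMDl // !divn_small //; lia.
by rewrite (exprD q x); ring.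
Qed.

(** * Sequences with prescribed remainders *)

Implicit Type r : seq nat.

(* [r] is the reversed remainder sequence and [z] the number of parts divisible
   by [s], zeros included. *)
Definition rem_set r z : set (seq nat) :=
  [set mu | [/\ sorted leq mu, size mu = (size r + z)%N & rems s mu = r]].

(** The empty sequence belongs to this set, by the default head 0. *)
Definition head_dvd : set (seq nat) := [set mu | s %| head 0 mu]%N.

Definition rem_set0 r z := rem_set r z `&` head_dvd.

Definition rem_set1 r z := rem_set r z `&` ~` head_dvd.

Lemma rems_cons x mu : rems s (x :: mu) =
  if (s %| x)%N then rems s mu else (x %% s)%N :: rems s mu.
Proof. by rewrite /rems /dvdn /=; case: eqP. Qed.

Lemma rems_shift mu : rems s (shift mu) = rems s mu.
Proof.
by rewrite /rems -map_comp; congr filter; apply: eq_map => x /=; rewrite modnDl.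
Qed.

Lemma size_rems mu : (size (rems s mu) <= size mu)%N.
Proof. by rewrite size_filter -(size_map (modn^~ s)) count_size. Qed.

Lemma head_dvd_shift mu : head_dvd (shift mu) <-> head_dvd mu.
Proof. by case: mu => //= x mu; rewrite /head_dvd /= dvdn_addr. Qed.

Lemma rem_set_shift r z mu : rem_set r z (shift mu) <-> rem_set r z mu.
Proof. by rewrite /rem_set /= sorted_shift size_map rems_shift. Qed.

Lemma rem_set_summable r z : fps_summable (rem_set r z) gap_weight.
Proof. by apply: (@gap_weight_summable (size r + z)) => mu []. Qed.

Lemma rem_set0_shift_invariant r z :
  shift_invariant (size r + z) (rem_set0 r z).
Proof.
split=> [mu [[]]//|mu [[]]//|mu].
by rewrite /rem_set0 /setI /= rem_set_shift head_dvd_shift.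
Qed.

Lemma rem_set1_shift_invariant r z :
  shift_invariant (size r + z) (rem_set1 r z).
Proof.
split=> [mu [[]]//|mu [[]]//|mu].
by rewrite /rem_set1 /setI /setC /= rem_set_shift head_dvd_shift.
Qed.

Local Notation weight_sum Y := (fps_sum Y gap_weight).

Lemma sum_rem_set r z : weight_sum (rem_set r z) =
  weight_sum (rem_set0 r z) + weight_sum (rem_set1 r z).
Proof. exact/fps_sumID/rem_set_summable. Qed.

Lemma sum_rem_set_nil : weight_sum (rem_set [::] 0) = 1.
Proof.
rewrite (_ : rem_set _ _ = [set [::]]) ?fps_sum1 /gap_weight ?mulr1 //.
by apply/seteqP; split=> [mu [_ /size0nil->]//|_ ->]; split.
Qed.

(** A head divisible by [s] and less than [s] is 0, and deleting a leading zero preserves the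
    weight. The tail is then an arbitrary member of [rem_set r z]. *)
Lemma sum_rem_set0S r z :
  (1 - C * Q ^+ (size r + z).+1) * weight_sum (rem_set0 r z.+1) =
    weight_sum (rem_set r z).
Proof.
have shX := rem_set0_shift_invariant r z.+1; rewrite addnS in shX.
rewrite (sum_head_lt shX).
rewrite [LHS](reindex_fps_sum (h := cons 0%N) (D := rem_set r z)).
  by apply: eq_fps_sum => mu _; rewrite /gap_weight /= div0n.
split=> [mu [sort_mu sz_mu rem_mu]|mu nu _ _ []//|].
  split=> //; split=> //; last exact: dvdn0.
  split; rewrite /= ?sz_mu ?addnS ?rems_cons ?dvdn0 //.
  by case: mu sort_mu {sz_mu rem_mu}.
move=> [|x mu] [[[sort_mu sz_mu rem_mu] dvd_x] /= lt_x].
  by rewrite addnS in sz_mu.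
have x0 : x = 0%N.
  by apply/eqP; move: dvd_x; rewrite /head_dvd /= /dvdn modn_small.
rewrite {}x0 in sort_mu rem_mu *; exists mu => //; split.
- exact: path_sorted sort_mu.
- by move: sz_mu; rewrite addnS => -[].
- by move: rem_mu; rewrite rems_cons dvdn0.
Qed.

(** The head would contribute no remainder, leaving too few parts for the remainders in [r]. *)
Lemma sum_rem_set00 r : (0 < size r)%N -> weight_sum (rem_set0 r 0) = 0.
Proof.
move=> r_gt0; rewrite (_ : rem_set0 r 0 = set0) ?fps_sum0 //.
apply/seteqP; split=> // -[|x mu] [[_ sz_mu rem_mu] dvd_x].
  by move: sz_mu r_gt0; rewrite addn0 => <-.
have := size_rems mu; rewrite (_ : rems s mu = r).
  by move: sz_mu; rewrite addn0 /= => <-; rewrite ltnn.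
by rewrite -rem_mu rems_cons; have -> : (s %| x)%N := dvd_x.
Qed.

Lemma sum_rem_set1_nil z : weight_sum (rem_set1 [::] z) = 0.
Proof.
rewrite (_ : rem_set1 _ _ = set0) ?fps_sum0 //.
apply/seteqP; split=> // -[|x mu] [[_ _ rem_mu]]; first by case; apply: dvdn0.
by rewrite /head_dvd /= => ndvd_x; move: rem_mu; rewrite rems_cons; case: ifP.
Qed.

Lemma sum_rem_set1_1 (x : nat) : (0 < x < s)%N ->
  (1 - C * Q) * weight_sum (rem_set1 [:: x] 0) = q ^+ x.
Proof.
move=> /andP[x_gt0 lt_xs]; have shX := rem_set1_shift_invariant [:: x] 0.
rewrite -[Q]expr1 (sum_head_lt shX) (_ : _ `&` _ = [set [:: x]]) ?fps_sum1.
  by rewrite /gap_weight /= subn0 divn_small // mul1r addn0.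
apply/seteqP; split=> [[|y [|? ?]] [[[_ sz_mu rem_mu] ndvd] /= lt_y] //|_ ->].
  move: rem_mu ndvd; rewrite rems_cons /head_dvd /= => + ndvd.
  by case: ifP => // _ [<-]; rewrite modn_small.
have ndvd : ~~ (s %| x)%N by rewrite gtnNdvd.
split=> //; split; last exact/negP.
by split; rewrite // rems_cons (negPf ndvd) modn_small.
Qed.

(** A head less than [s] equals its remainder, here [x]. The size hypothesis excludes an empty tail,
    whose default head 0 would violate [x <= head 0 mu]; that case is [sum_rem_set1_1]. *)
Lemma rem_set1_head_lt (x : nat) r z mu : (0 < x < s)%N -> (0 < size r + z)%N ->
  rem_set1 (x :: r) z mu /\ (head 0 mu < s)%N <->
  cons_set x (rem_set0 r z) mu \/ cons_set x (rem_set1 r z) mu.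
Proof.
move=> /andP[x_gt0 lt_xs] n_gt0; have ndvd : ~~ (s %| x)%N by rewrite gtnNdvd.
split.
  case: mu => [|y mu] [[[sort_mu sz_mu rem_mu] ndvd_y] /= lt_y].
    by case: ndvd_y; apply: dvdn0.
  have [def_x rem_mu'] : y = x /\ rems s mu = r.
    move: rem_mu ndvd_y; rewrite rems_cons /head_dvd /= => + ndvd_y.
    by case: ifP => // _ [<- <-]; rewrite modn_small.
  rewrite {y}def_x in sort_mu lt_y rem_mu ndvd_y sz_mu *.
  have Xmu : rem_set r z mu.
    split=> //; [exact: path_sorted sort_mu | by case: sz_mu].
  have le_x : (x <= head 0 mu)%N.
    by move: sort_mu sz_mu; case: (mu) => [|h nu] /= => [_ []|/andP[]//]; lia.
  by have [dvd_mu|ndvd_mu] := pselect (head_dvd mu); [left | right]; exists mu.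
have in_cons nu : rem_set r z nu -> (x <= head 0 nu)%N ->
    rem_set1 (x :: r) z (x :: nu) /\ (head 0 (x :: nu) < s)%N.
  move=> [sort_nu sz_nu rem_nu] le_x; split=> //; split; last exact/negP.
  split; rewrite /= ?sz_nu ?rems_cons ?(negPf ndvd) ?modn_small ?rem_nu //.
  by case: nu sort_nu {sz_nu rem_nu} le_x => //= h nu ->; rewrite andbT.
by case=> -[nu [[Xnu _] /= le_x] <-]; apply: in_cons.
Qed.

Lemma sum_rem_set1_cons (x : nat) r z : (0 < x < s)%N -> (0 < size r + z)%N ->
  (1 - C * Q ^+ (size r + z).+1) * weight_sum (rem_set1 (x :: r) z) =
  q ^+ x * (Q ^+ (size r + z) * weight_sum (rem_set0 r z) +
    Q ^+ ((size r + z) * (head 0 r < x)%N) * weight_sum (rem_set1 r z)).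
Proof.
move=> bnd_x n_gt0; have [x_gt0 lt_xs] := andP bnd_x.
have shX0 := rem_set0_shift_invariant r z.
have shX1 := rem_set1_shift_invariant r z.
rewrite -[(_ + z).+1]/(size (x :: r) + z)%N.
rewrite (sum_head_lt (rem_set1_shift_invariant (x :: r) z)).
rewrite (fps_sumID (fun mu => head_dvd (behead mu))); last first.
  by apply: (@gap_weight_summable (size (x :: r) + z)) => mu [[[]]].
rewrite (@eq_fps_suml _ _ _ (cons_set x (rem_set0 r z))); last first.
  move=> mu; split=> [[/rem_set1_head_lt[]//]|].
    by move=> -[nu [[_ ndvd_nu] _] <-] dvd_nu; case: ndvd_nu.
  move=> Xmu; split; first by apply/rem_set1_head_lt => //; left.
  by case: Xmu => nu [[]] _ dvd_nu _ <-.
rewrite (@eq_fps_suml _ _ (_ `&` _ `&` ~` _)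
           (cons_set x (rem_set1 r z))); last first.
  move=> mu; split=> [[/rem_set1_head_lt[]//]|].
    by move=> -[nu [[_ dvd_nu] _] <-] ndvd_nu; case: ndvd_nu.
  move=> Xmu; split; first by apply/rem_set1_head_lt => //; right.
  by case: Xmu => nu [[]] _ dvd_nu _ <-.
case: (size r + z)%N n_gt0 shX0 shX1 => // n _ shX0 shX1.
(* Heads divisible by [s] have residue 0, which is less than [x], so this half always takes the
   shifted case. *)
rewrite (@sum_cons_set n _ x 0) //; last by move=> mu [_ /eqP].
rewrite x_gt0 muln1 mulrDr !mulrA; congr (_ + _).
have rem_head mu : rem_set1 r z mu -> (head 0 mu %% s)%N = head 0%N r.
  case: mu => [|y mu] [[_ _ <-] ndvd]; first by case: ndvd; apply: dvdn0.
  by move: ndvd; rewrite /head_dvd /= rems_cons => ndvd; case: ifP.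
(* The bound of [head 0 r] by [s] is read off a member of the set; without members both sides
   vanish. *)
have [->|/set0P[mu Xmu]] := eqVneq (rem_set1 r z) set0.
  rewrite (_ : cons_set _ _ = set0) ?fps_sum0 ?mulr0 //.
  by apply/seteqP; split=> // nu [? [[]]].
rewrite (@sum_cons_set n _ x (head 0%N r)) //.
by rewrite -(rem_head _ Xmu) ltn_pmod.
Qed.

End ShiftedSums.

(* [asc_maj (rev rho)] is the sum of the [j] with [rho_j < rho_(j+1)]. *)
Fixpoint asc_maj (r : seq nat) : nat :=
  if r is x :: r' then (size r' * (head 0 r' < x) + asc_maj r')%N else 0%N.

(** * Closed forms with a fixed number of parts *)

Section ClosedForms.
Variables (s : nat) (A : comUnitRingType) (c : A).
Hypothesis s_gt0 : (0 < s)%N.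

Let q : fps A := fpsX.
Let Q : fps A := q ^+ s.
Let C : fps A := fpsC c.
Let P n := qpoch (C * Q) Q n.
Local Notation weight_sum Y := (fps_sum Y (gap_weight s c)).
Local Notation bounded := (all (fun x => 0 < x < s)%N).

(** The constant coefficient is 1, since [Q ^+ i] has positive order. *)
Lemma unit_1subMXs (f : fps A) i : (0 < i)%N -> 1 - f * Q ^+ i \is a GRing.unit.
Proof.
move=> i_gt0; change (fcoef (1 - f * Q ^+ i) 0 \is a GRing.unit).
rewrite -[fcoef _ 0]/(1 - fcoef (f * Q ^+ i) 0) -exprM.
have /(@fps_ord_geMl _ _ f)-> := @fps_ord_geXn A (s * i).
  by rewrite subr0 unitr1.
by rewrite muln_gt0 s_gt0.
Qed.

Lemma unit_1subXs i : (0 < i)%N -> 1 - Q ^+ i \is a GRing.unit.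
Proof. by rewrite -[Q ^+ i]mul1r; apply: unit_1subMXs. Qed.

Let PS n : P n.+1 = P n * (1 - C * Q ^+ n.+1).
Proof. exact: qpochCQS. Qed.

Let P0 : P 0 = 1.
Proof. exact: big_nil. Qed.

Let K r := q ^+ sumn r * Q ^+ asc_maj r.

Let K_cons x r :
  K (x :: r) = q ^+ x * Q ^+ (size r * (head 0 r < x)%N) * K r.
Proof. by rewrite /K /= (exprD q) (exprD Q); ring. Qed.

Definition rem_set_formula r := forall z,
  P (size r + z) * weight_sum (rem_set s r z) =
    K r * qbinom Q (size r + z) (size r).

Definition rem_set1_formula x r := forall z,
  P (size r + z).+1 * weight_sum (rem_set1 s (x :: r) z) =
    K (x :: r) * (Q ^+ z * qbinom Q (size r + z) (size r)).

Let PX0 r z : P (size r + z).+1 * weight_sum (rem_set0 s r z.+1) =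
  P (size r + z) * weight_sum (rem_set s r z).
Proof. by rewrite PS -mulrA sum_rem_set0S. Qed.

Let qbn0 n : qbinom Q n 0 = 1.
Proof. exact/qbinomn0/unit_1subXs. Qed.

Let qbnn n : qbinom Q n n = 1.
Proof. exact/qbinomnn/unit_1subXs. Qed.

Lemma rem_set_formula_nil : rem_set_formula [::].
Proof.
elim=> [|z IHz].
  by rewrite sum_rem_set_nil qbn0 /K /= addn0 P0 !expr0 !mulr1.
by rewrite sum_rem_set sum_rem_set1_nil addr0 addnS PX0 IHz !qbn0.
Qed.

(** Induction on [z]: removing a leading zero lowers [z], a non-divisible head is given by the
    hypothesis, and the two contributions add up by [qbinomS_high]. *)
Lemma rem_set_formula_cons x r :
  rem_set1_formula x r -> rem_set_formula (x :: r).
Proof.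
move=> form1; elim=> [|z IHz]; rewrite sum_rem_set.
  by rewrite sum_rem_set00 // add0r form1 !addn0 !qbnn !mulr1.
rewrite mulrDr addnS PX0 IHz -addnS form1 -mulrDr addrC.
by rewrite qbinomS_high //; exact: unit_1subXs.
Qed.

Lemma rem_set1_formula_1 x : (0 < x < s)%N -> rem_set1_formula x [::].
Proof.
move=> bnd_x [|z]; rewrite PS -mulrA.
  rewrite expr1 sum_rem_set1_1 // P0 qbn0 /K /= addn0.
  by rewrite !mulr1 mul1r.
rewrite sum_rem_set1_cons // sum_rem_set1_nil mulr0 addr0 addnS.
rewrite mulrCA [P _ * _]mulrCA PX0 rem_set_formula_nil.
by rewrite !qbn0 /K /= addn0 !mulr1.
Qed.

(** The two terms of [sum_rem_set1_cons] are the two terms of a Pascal rule. At an ascent [y < x]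
    both carry the power of [Q] counted by [asc_maj], leaving [qbinomS_high]; otherwise only the
    divisible half does, which is [qbinomS_low]. *)
Lemma rem_set1_formula_cons x y r : (0 < x < s)%N ->
  rem_set_formula (y :: r) -> rem_set1_formula y r ->
  rem_set1_formula x (y :: r).
Proof.
move=> bnd_x form form1 [|z]; rewrite PS -mulrA sum_rem_set1_cons //.
  rewrite sum_rem_set00 // mulr0 add0r mulrCA [P _ * _]mulrCA form1.
  by rewrite !addn0 !qbnn !mulr1 [in RHS]K_cons -/q -/Q; ring.
rewrite mulrCA mulrDr [P _ * _]mulrCA [P _ * (_ * _)]mulrCA.
rewrite [X in P X * weight_sum (rem_set0 _ _ _)]addnS PX0 form.
rewrite form1 [in RHS]K_cons -/q -/Q; case: (_ < x)%N.
  rewrite qbinomS_high; last exact: unit_1subXs.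
  rewrite !muln1 exprD; move: (Q ^+ _) (Q ^+ _) (q ^+ _) (K _) (qbinom _ _ _).
  by move: (qbinom _ _ _) => *; ring.
rewrite qbinomS_low; last exact: unit_1subXs.
rewrite !muln0 !expr0 exprD.
move: (Q ^+ _) (Q ^+ _) (q ^+ _) (K _) (qbinom _ _ _) (qbinom _ _ _).
by move=> *; ring.
Qed.

Lemma rem_set_formulas x r : bounded (x :: r) ->
  rem_set_formula (x :: r) /\ rem_set1_formula x r.
Proof.
elim: r x => [|y r IHr] x /= /andP[bnd_x].
  move=> _; have form1 := rem_set1_formula_1 bnd_x.
  exact (conj (rem_set_formula_cons form1) form1).
case/IHr=> form form'; have form1 := rem_set1_formula_cons bnd_x form form'.
exact (conj (rem_set_formula_cons form1) form1).
Qed.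

(* The seqs with a positive head are the partitions proper: an increasing seq
   in [rem_set r z] may start with zeros. *)
Lemma sum_positive_head x r z : bounded (x :: r) ->
  P (size r + z).+1 *
      weight_sum (rem_set s (x :: r) z `&` [set mu | 0 < head 0 mu]%N) =
  K (x :: r) * (Q ^+ z * qbinom Q (size r + z) (size r) +
    C * Q ^+ (size r + z).+1 *
      \sum_(0 <= j < z) Q ^+ j * qbinom Q (size r + j) (size r)).
Proof.
move=> /rem_set_formulas[form form1].
have shX := rem_set0_shift_invariant s (x :: r) z.
rewrite (fps_sumID (head_dvd s)); last first.
  by apply: (@gap_weight_summable _ _ _ (size (x :: r) + z)) => mu [[]].
(* A positive head divisible by [s] is at least [s], so this half is the image of all of [rem_set0]
   under the shift. *)
rewrite (@eq_fps_suml _ _ _ (rem_set0 s (x :: r) z `&`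
                               [set mu | s <= head 0 mu]%N)); last first.
  move=> mu; split=> [[[Xmu h_gt0] dvd_h]|[[Xmu dvd_h] /= le_s]].
    by split=> //=; apply: dvdn_leq.
  by split=> //; split=> //=; apply: leq_trans le_s.
rewrite (@eq_fps_suml _ _ (_ `&` _ `&` ~` _)
           (rem_set1 s (x :: r) z)); last first.
  move=> mu; split=> [[[Xmu _] ndvd_h]//|[Xmu ndvd_h]].
  split=> //; split=> //=; rewrite lt0n; apply/eqP => h0.
  by case: ndvd_h; rewrite /head_dvd /= h0 dvdn0.
rewrite (sum_head_ge c s_gt0 shX) mulrDr form1 mulrDr addrC; congr (_ + _).
rewrite mulrCA [RHS]mulrCA; congr (_ * _).
(* For positive [z] the leading zero of a member of [rem_set0] is removed, and the closed form
   matches the hockey-stick sum. *)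
case: z {shX} => [|z]; first by rewrite sum_rem_set00 // big_geq // !mulr0.
rewrite sum_qbinom; last exact: unit_1subXs.
by rewrite [X in P X.+1]addnS -addSn -[(size r).+1]/(size (x :: r)) PX0 form.
Qed.

End ClosedForms.

(** * Partitions *)

Section PartitionStatistics.
Local Open Scope nat_scope.
Implicit Types la rho : seq nat.

Lemma count_cells (p : pred (nat * nat)) la : count p (cells la) =
  \sum_(i < size la) count (fun j => p (val i, j)) (iota 0 (nth 0 la i)).
Proof.
rewrite /cells count_flatten sumnE -map_comp big_map.
rewrite -(big_mkord xpredT
            (fun i => count (fun j => p (i, j)) (iota 0 (nth 0 la i)))).
by rewrite /index_iota subn0; apply: eq_bigr => i _ /=; rewrite count_map.
Qed.

Lemma mem_cells la i j : ((i, j) \in cells la) = (j < nth 0 la i).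
Proof.
apply/allpairsPdep/idP => [[i' [j' [_ + [-> ->]]]]|lt_j].
  by rewrite mem_iota.
exists i, j; split=> //; rewrite mem_iota add0n //=.
by rewrite ltnNge; apply: contraL lt_j => /(nth_default 0)->.
Qed.

(** As rows weakly decrease, only the next row matters; below the last row the default 0 makes every
    leg empty. *)
Lemma leg_eq0 la i j : sorted geq la ->
  (leg la (i, j) == 0) = (nth 0 la i.+1 <= j).
Proof.
move=> sort_la; rewrite eqn0Ngt -has_count leqNgt; congr negb.
apply/hasP/idP => [[[i' j']]|lt_j]; last first.
  by exists (i.+1, j); rewrite ?mem_cells //= eqxx ltnSn.
rewrite mem_cells /= => lt_j' /andP[/eqP<- lt_i]; apply: leq_trans lt_j' _.
have [lt_i'|/(nth_default 0)->//] := ltnP i' (size la).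
apply: (sorted_leq_nth (rev_trans leq_trans) leqnn) => //.
by rewrite inE (leq_ltn_trans lt_i).
Qed.

Lemma arm_cell la i j : i < size la -> arm la (i, j) = nth 0 la i - j.+1.
Proof.
move=> lt_i; rewrite /arm count_cells (bigD1 (Ordinal lt_i)) //= eqxx.
rewrite big1 ?addn0 => [|k]; last first.
  rewrite -val_eqE /= => /negPf ->.
  by rewrite (eq_count (a2 := pred0)) ?count_pred0.
elim: (nth 0 la i) => // n IHn.
rewrite -[X in iota 0 X]addn1 iotaD count_cat IHn /=.
by case: ltnP => /=; lia.
Qed.

(** In a row of length [b + d] above one of length [b], the cells with empty leg have [arm + 1]
    running through [1, ..., d], among which [d %/ s] are multiples of [s]. *)
Lemma count_dvd_iota s b d : 0 < s ->
  count (fun j => (b <= j) && (s %| b + d - j)) (iota 0 (b + d)) = d %/ s.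
Proof.
move=> s_gt0; rewrite iotaD count_cat (eq_in_count (a2 := pred0)); last first.
  by move=> j; rewrite mem_iota /=; case: ltnP.
rewrite count_pred0 !add0n; elim: d b => [|d IHd] b; first by rewrite div0n.
rewrite divnS // -(IHd b.+1) /= leqnn addKn; congr (_ + _).
apply: eq_in_count => j; rewrite mem_iota addSnnS => /andP[lt_bj _].
by rewrite (ltnW lt_bj) lt_bj.
Qed.

Lemma gap_stat_rcons s p mu x :
  gap_stat s p (rcons mu x) = gap_stat s p mu + (x - last p mu) %/ s.
Proof. by elim: mu p => [|y mu IHmu] p /=; rewrite ?addn0 // IHmu addnA. Qed.

Lemma gap_stat_rev s la : gap_stat s 0 (rev la) =
  \sum_(i < size la) (nth 0 la i - nth 0 la i.+1) %/ s.
Proof.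
elim: la => [|x la IHla]; first by rewrite big_ord0.
rewrite rev_cons gap_stat_rcons big_ord_recl IHla addnC.
congr ((x - _) %/ s + _).
by case: (la) => // y la'; rewrite rev_cons last_rcons.
Qed.

Lemma cstat_gap_stat s la : 0 < s -> is_intpart la ->
  cstat s la = gap_stat s 0 (rev la).
Proof.
move=> s_gt0 /andP[sort_la _]; rewrite gap_stat_rev /cstat count_cells.
apply: eq_bigr => i _; set a := nth 0 la i; set b := nth 0 la i.+1.
have le_ba : b <= a.
  rewrite /b; have [lt_i|/(nth_default 0)->//] := ltnP i.+1 (size la).
  by apply: (sorted_leq_nth (rev_trans leq_trans) leqnn); rewrite ?inE.
rewrite -(count_dvd_iota b (a - b) s_gt0) subnKC //.
apply: eq_in_count => j; rewrite mem_iota => /andP[_ lt_ja].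
by rewrite leg_eq0 // arm_cell ?ltn_ord // addn1 subnSK.
Qed.

Lemma rstat_size s la : rstat s la = size la - size (rems s la).
Proof.
by rewrite size_filter count_map -(count_predC (dvdn s) la) addnK.
Qed.

Lemma rems_rev s la : rems s (rev la) = rev (rems s la).
Proof. by rewrite /rems map_rev filter_rev. Qed.

(** Each position [j] below the length of [rho] is either a weak descent or an ascent, so together
    the two statistics sum all these positions. *)
Lemma wmaj_asc_maj rho : wmaj rho + asc_maj (rev rho) = 'C(size rho, 2).
Proof.
elim/last_ind: rho => [|rho x IHrho]; first by rewrite /wmaj big_geq.
rewrite size_rcons binS bin1 -IHrho rev_rcons /= size_rev.
have -> : head 0 (rev rho) = nth 0 rho (size rho).-1.
  by case/lastP: (rho) => // rho' y; rewrite rev_rcons nth_last last_rcons.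
have -> : wmaj (rcons rho x) =
    wmaj rho + size rho * (x <= nth 0 rho (size rho).-1).
  rewrite /wmaj size_rcons; case def_n: (size rho) => [|n].
    by rewrite !big_geq.
  rewrite big_mkcond big_nat_recr //= -big_mkcond /=; congr (_ + _).
    rewrite big_nat_cond [RHS]big_nat_cond; apply: eq_bigl => j.
    case: (1 <= j < n.+1) / andP => //= -[j_gt0 lt_j].
    by rewrite !nth_rcons def_n lt_j (leq_ltn_trans (leq_pred j) lt_j).
  rewrite !nth_rcons def_n /= ltnn eqxx ltnSn.
  by case: leqP; rewrite ?muln1 ?muln0.
by case: leqP => _; lia.
Qed.

End PartitionStatistics.

(** * Comparison of the two sides *)

Section GeneratingFunction.
Variables (A : comUnitRingType) (r c : A) (s m : nat) (rho : seq nat).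
Hypotheses (m_gt0 : (0 < m)%N) (size_rho : size rho = m).
Hypothesis rho_bound : all (fun x => 0 < x < s)%N rho.

Let q : fps A := fpsX.
Let Q : fps A := q ^+ s.
Let R : fps A := fpsC r.
Let C : fps A := fpsC c.
Let P n := qpoch (C * Q) Q n.
Let weight (la : intpart) : fps A :=
  R ^+ rstat s la * C ^+ cstat s la * q ^+ sumn la.
Let inner i k := C * Q ^+ k / qpoch (C * Q) Q k * R ^+ maxn (i - m) (k - m).
Let b i := Q ^+ ('C(m, 2) + (i - m)) * qbinom Q (i - 1) (m - 1).
Let outer i :=
  b i * (R ^+ (i - m) + fps_sum [set k | (1 <= k)%N] (inner i)).
Let D := [set la : intpart | rems s la = rho].
Let W N := fps_sum (rem_set s (rev rho) (N - m) `&` [set mu | 0 < head 0 mu]%N)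
             (gap_weight s c).

Let s_gt0 : (0 < s)%N.
Proof.
move: size_rho rho_bound m_gt0; case: (rho) => [<- //|x rho' _ /=].
by case/andP=> /andP[_ lt_xs] _ _; apply: leq_ltn_trans lt_xs.
Qed.

Lemma weight_intpart (la : intpart) : D la ->
  weight la = R ^+ (size la - m) * gap_weight s c (rev la).
Proof.
move=> Dla; have int_la : is_intpart la := valP la.
rewrite /weight rstat_size (_ : rems s la = rho) // size_rho cstat_gap_stat //.
by rewrite /gap_weight sumn_rev mulrA.
Qed.

Lemma size_intpart (la : intpart) : (size la <= sumn la)%N.
Proof.
case: la => /= la /andP[_]; elim: la => //= x la IHla.
by rewrite inE negb_or => /andP[x_gt0 /IHla]; lia.
Qed.

Lemma coef_weight (la : intpart) n : fcoef (weight la) n <> 0 -> sumn la = n.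
Proof.
rewrite /weight !fpsCX -mulrA !fcoefCM fcoefXn.
by case: eqVneq => // _; rewrite !mulr0.
Qed.

Lemma weight_summable : fps_summable D weight.
Proof.
move=> n; apply: (sub_finite_set (B := val @^-1` _)); last first.
  apply: finite_preimage (finite_bounded_seqs n n).
  by move=> la la' _ _; apply: val_inj.
move=> la [_ /coef_weight <-]; split; first exact: size_intpart.
by move=> x; apply: leq_mem_sumn.
Qed.

(** In increasing order, having no zero part amounts to a positive head. *)
Lemma intpart_bij N : (m <= N)%N ->
  set_bij (D `&` [set la | size la = N])
    (rem_set s (rev rho) (N - m) `&` [set mu | 0 < head 0 mu]%N)
    (fun la : intpart => rev la).
Proof.
move=> le_mN; split.
- move=> la [rem_la sz_la].
  have /andP[sort_la nz_la] : is_intpart la := valP la.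
  split; first split.
  + by rewrite rev_sorted.
  + by rewrite !size_rev size_rho subnKC.
  + by rewrite rems_rev rem_la.
  have: head 0%N (rev la) \in rev la.
    by rewrite -nth0 mem_nth // size_rev sz_la (leq_trans m_gt0).
  by rewrite mem_rev /= lt0n; apply: contraL => /eqP->.
- by move=> la la' _ _ /(can_inj revK)/val_inj.
- move=> mu [[sort_mu sz_mu rem_mu] /= h_gt0].
  rewrite size_rev size_rho subnKC // in sz_mu.
  have mu_gt0 : all (leq 1) mu.
    by rewrite all_leq_head // sz_mu (leq_trans m_gt0).
  have int_mu : is_intpart (rev mu).
    rewrite /is_intpart rev_sorted sort_mu mem_rev /=.
    by apply/negP => /(allP mu_gt0).
  exists (IntPart int_mu); last by rewrite /= revK.
  by split; rewrite /D /= ?rems_rev ?rem_mu ?revK // size_rev.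
Qed.

Lemma sum_weight_size N : (m <= N)%N ->
  fps_sum (D `&` [set la | size la = N]) weight = R ^+ (N - m) * W N.
Proof.
move=> le_mN; rewrite -fps_sumM; last first.
  by apply: (@gap_weight_summable _ _ _ (size (rev rho) + (N - m))) => mu [[]].
rewrite [RHS](reindex_fps_sum _ (intpart_bij le_mN)).
by apply: eq_fps_sum => la [Dla sz_la]; rewrite weight_intpart // sz_la.
Qed.

(** A partition of [n] with remainders [rho] has at least [m] and at most [n] parts. *)
Lemma fcoef_sum_weight n M : (n + m < M)%N ->
  fcoef (fps_sum D weight) n = fcoef (\sum_(m <= N < M) R ^+ (N - m) * W N) n.
Proof.
move=> lt_M; rewrite (@fcoef_fps_sum_fibers _ _ (fun la : intpart => size la)
  D weight n m M weight_summable) => [|la Dla /coef_weight sum_la].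
  rewrite fcoef_sum; apply: eq_big_nat => N /andP[le_mN _].
  by rewrite sum_weight_size.
rewrite -size_rho -[in X in (X <= _)%N]Dla size_rems /=.
by rewrite (leq_ltn_trans (size_intpart la)) // sum_la; lia.
Qed.

Lemma W_formula N : (m <= N)%N ->
  Q ^+ wmaj rho * W N = q ^+ sumn rho * ((P N)^-1 *
    (b N + C * Q ^+ N * \sum_(m <= i < N) b i)).
Proof.
move=> le_mN.
have UP : P N \is a GRing.unit.
  by apply: qpochCQ_unit => i; apply: unit_1subMXs.
apply: (mulIr UP).
rewrite /W; case def_r: (rev rho) => [|x r'].
  by move: size_rho m_gt0; rewrite -size_rev def_r => <-.
have bnd : all (fun x => 0 < x < s)%N (x :: r') by rewrite -def_r all_rev.
have sz_r' : m = (size r').+1 by rewrite -size_rho -size_rev def_r.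
have := sum_positive_head c s_gt0 (N - m) bnd.
rewrite (_ : (size r' + (N - m)).+1 = N); last by lia.
rewrite -/q -/Q -/C -/(P N) -def_r sumn_rev.
set S := fps_sum _ _ => PS.
have -> : Q ^+ wmaj rho * S * P N = Q ^+ wmaj rho * (P N * S) by ring.
rewrite PS.
have -> : \sum_(m <= i < N) b i = Q ^+ 'C(m, 2) *
    \sum_(0 <= j < N - m) Q ^+ j * qbinom Q (size r' + j) (size r').
  rewrite mulr_sumr -{1}[m]add0n big_addn; apply: eq_big_nat => j _.
  rewrite /b exprD addnK -mulrA; congr (_ * (_ * qbinom Q _ _)); lia.
have -> : b N = Q ^+ 'C(m, 2) *
    (Q ^+ (N - m) * qbinom Q (size r' + (N - m)) (size r')).
  rewrite /b exprD -mulrA; congr (_ * (_ * qbinom Q _ _)); lia.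
(* The factor [Q ^+ wmaj rho] completes the ascent power to the binomial exponent in [b]. *)
rewrite -size_rho -wmaj_asc_maj exprD size_rho.
set X := \sum_(_ <= _ < _) _; set Y := qbinom _ _ _.
have -> (u v : fps A) : u * ((P N)^-1 * v) * P N = u * v.
  by rewrite mulrA mulrAC -[u / _ * _]mulrA mulVr ?mulr1.
ring.
Qed.

Lemma inner_ord i k : (1 <= k)%N -> fps_ord_ge (k - 1) (inner i k).
Proof.
move=> _; rewrite /inner -!mulrA; apply/fps_ord_geMl/fps_ord_geMr.
rewrite /Q -exprM; apply: fps_ord_geW (@fps_ord_geXn _ _).
by rewrite (leq_trans (leq_subr _ _)) // leq_pmull.
Qed.

Lemma outer_ord i : (m <= i)%N -> fps_ord_ge (i - m) (outer i).
Proof.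
move=> _; rewrite /outer /b -!mulrA; apply: fps_ord_geMr.
rewrite /Q -exprM; apply: fps_ord_geW (@fps_ord_geXn _ _).
by rewrite (leq_trans (leq_addl 'C(m, 2) _)) // leq_pmull.
Qed.

Lemma inner_summable i : fps_summable [set k | (1 <= k)%N] (inner i).
Proof. exact/fps_summable_nat/inner_ord. Qed.

Lemma outer_summable : fps_summable [set i | (m <= i)%N] outer.
Proof. exact/fps_summable_nat/outer_ord. Qed.

Lemma fcoef_sum_outer n M : (n + m < M)%N ->
  fcoef (fps_sum [set i | (m <= i)%N] outer) n =
  fcoef (\sum_(m <= i < M)
           b i * (R ^+ (i - m) + \sum_(1 <= k < M) inner i k)) n.
Proof.
move=> lt_M; rewrite (fcoef_fps_sum_nat outer_ord lt_M) !fcoef_sum.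
apply: eq_bigr => i _; apply: fcoefM_eqr => j le_jn; rewrite !fcoefD.
(* The inner index starts at 1, so the cut at [M] needs [j + 1 < M], which follows from [0 < m]. *)
by congr (_ + _); apply: (fcoef_fps_sum_nat (@inner_ord i)); lia.
Qed.

Lemma rem_generating_function :
  Q ^+ wmaj rho * fps_sum D weight =
    q ^+ sumn rho * fps_sum [set i | (m <= i)%N] outer.
Proof.
apply: fpsP => n; set M := (n + m).+1.
have lt_M j : (j <= n)%N -> (j + m < M)%N by rewrite ltnS leq_add2r.
rewrite (fcoefM_eqr _ (fun j le_j => fcoef_sum_weight (lt_M j le_j))).
rewrite [RHS](fcoefM_eqr _ (fun j le_j => fcoef_sum_outer (lt_M j le_j))).
rewrite collect_qpoch //; last by move=> i; apply: unit_1subMXs.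
congr fcoef; rewrite !mulr_sumr; apply: eq_big_nat => N /andP[le_mN _].
by rewrite mulrCA W_formula //; ring.
Qed.

End GeneratingFunction.

Theorem theorem4p2 (s m : nat) (rho : m.-tuple nat)
    (s_gt0 : (1 <= s)%N) (m_gt0 : (1 <= m)%N)
    (rho_bound : forall j : 'I_m, (1 <= tnth rho j <= s - 1)%N) :
  let q : fps {poly {poly int}} := fpsX in
  let Q := q ^+ s in
  let R := varR in
  let C := varC in
  let weight (la : intpart) :=
    R ^+ rstat s la * C ^+ cstat s la * q ^+ sumn la in
  let inner (i k : nat) :=
    (C * Q ^+ k) / qpoch (C * Q) Q k * R ^+ maxn (i - m) (k - m) in
  let outer (i : nat) :=
    Q ^+ ('C(m, 2) + (i - m)) * qbinom Q (i - 1) (m - 1) *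
    (R ^+ (i - m) + fps_sum [set k | (1 <= k)%N] (inner i)) in
  [/\ fps_summable [set la : intpart | rems s la = rho] weight,
      forall i, (m <= i)%N -> fps_summable [set k | (1 <= k)%N] (inner i),
      fps_summable [set i | (m <= i)%N] outer
    & tofrac (fps_sum [set la : intpart | rems s la = rho] weight) =
      tofrac q ^+ sumn rho * tofrac Q ^- wmaj rho *
      tofrac (fps_sum [set i | (m <= i)%N] outer) ].
Proof.
move=> q Q R C weight inner outer.
have sz_rho : size rho = m := size_tuple rho.
have bnd : all (fun x => 0 < x < s)%N rho.
  apply/(all_nthP 0%N) => j; rewrite sz_rho => lt_j.
  by have := rho_bound (Ordinal lt_j); rewrite (tnth_nth 0%N) /=; lia.
split.
- exact (weight_summable 'X 'X%:P m_gt0 sz_rho bnd).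
- by move=> i _; exact (inner_summable 'X 'X%:P m_gt0 sz_rho bnd i).
- exact (outer_summable 'X 'X%:P m_gt0 sz_rho bnd).
(* [Q] has no inverse among power series; in the fraction field the negative power is cleared by
   multiplying with [Q ^+ wmaj rho]. *)
have Q_neq0 : tofrac Q != 0.
  rewrite tofrac_eq0; apply/eqP => /(congr1 (fun f => fcoef f s)).
  by rewrite fcoefXn eqxx => /eqP; rewrite oner_eq0.
apply: (mulfI (expf_neq0 (wmaj rho) Q_neq0)).
have gf : Q ^+ wmaj rho * fps_sum [set la : intpart | rems s la = rho] weight =
    q ^+ sumn rho * fps_sum [set i | (m <= i)%N] outer.
  exact (rem_generating_function 'X 'X%:P m_gt0 sz_rho bnd).
rewrite -[in LHS]tofracXn -tofracM gf tofracM tofracXn !mulrA.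
by rewrite [_ * tofrac q ^+ _]mulrC mulfK // expf_neq0.
Qed.
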